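(* Let $f\in\Gamma_0(X)$ with $Y\cap\operatorname{dom}f^*\neq\varnothing$ and let $(e,d)=(e_f,d_f)\in Y\times Y$ be the pair defined in the context. Then the following hold: (i) The set $Z$ of phantom cycles of $f$, which is defined to be the set of classical cycles of the function $\mathrm{cl}(f\,\Box\,\iota_{Y^\perp})$, i.e., $$Z=\{z\in X: z=\operatorname{Prox}_{\mathrm{cl}(f\,\Box\,\iota_{Y^\perp})}(Rz)\},$$ is always nonempty and $Z=e+Y^\perp$. Consequently, $Z$ contains infinitely many elements whenever $Y^\perp=\operatorname{Fix}R\neq\{0\}$. (ii) The phantom gap vector of $f$, i.e., the vector $d_{\mathrm{cl}(f\,\Box\,\iota_{Y^\perp})}$, is equal to $d=Sz\in Y$ for every $z\in Z$; moreover, $e_{\mathrm{cl}(f\,\Box\,\iota_{Y^\perp})}=e$.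
   Context: $X$ is a real Hilbert space with inner product $\langle\cdot,\cdot\rangle$ and norm $\|\cdot\|$. $m\in\{1,2,\dots\}$ and $R:X\to X$ is a linear isometry with $R^m=\mathrm{Id}$. $\operatorname{Fix}R=\{x: Rx=x\}$, $Y=(\operatorname{Fix}R)^\perp$ (so $Y^\perp=\operatorname{Fix}R$), $S=R-\mathrm{Id}$, $Q=\frac1m\sum_{i=1}^{m-1}iR^i$. $\Gamma_0(X)$ is the set of proper lower semicontinuous convex functions $X\to\,]-\infty,+\infty]$. $f^*(x^* )=\sup_{x\in X}(\langle x,x^*\rangle-f(x))$ is the Fenchel conjugate; $\operatorname{dom}f=\{f<+\infty\}$; $(f\,\Box\,g)(x)=\inf_{y\in X}(f(y)+g(x-y))$ is the infimal convolution; $\mathrm{cl}\,f$ is the lower semicontinuous convex hull of $f$ (largest lower semicontinuous convex function $\le f$); $\partial f$ is the convex subdifferential; $\operatorname{Prox}_f=(\mathrm{Id}+\partial f)^{-1}$ is the (single-valued) proximal mapping of $f\in\Gamma_0(X)$; $\iota_C$ is the indicator function ($0$ on $C$, $+\infty$ off $C$). A classical cycle of $g\in\Gamma_0(X)$ is a $z\in X$ with $z=\operatorname{Prox}_g Rz$. The pair $(e_g,d_g)$: for $g\in\Gamma_0(X)$ with $Y\cap\operatorname{dom}g^*\ne\varnothing$, there is a unique pair $(e,d)\in Y\times Y$ such that $d=Se\in\operatorname{dom}g^*$, $e=Qd$, and $g^*(Se)+\langle y-Se,e\rangle-g^*(y)\le0$ for all $y\in Y$ (equivalently, $e\in\partial(g^*+\iota_Y)(Se)$);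 it is denoted $(e_g,d_g)$. Under the hypotheses of the claim, $g=\mathrm{cl}(f\,\Box\,\iota_{Y^\perp})$ lies in $\Gamma_0(X)$, $g^*=f^*+\iota_Y$, and $Y\cap\operatorname{dom}g^*\neq\varnothing$, so $(e_g,d_g)$ is defined for this $g$. *)

(* Defs.v *)
From HB Require Import structures.
From mathcomp Require Export all_boot all_order all_algebra.
From mathcomp Require Export all_classical all_reals all_analysis.
From mathcomp Require Export sesquilinear.

Set Implicit Arguments.
Unset Strict Implicit.
Unset Printing Implicit Defensive.

Import Order.TTheory GRing.Theory Num.Theory.
Import numFieldNormedType.Exports.
Export numFieldNormedType.Exports.

Local Open Scope classical_set_scope.
Local Open Scope ring_scope.

Section convex_analysis.
Context {K : realType} {X : completeNormedModType K}.
Implicit Types (f g h : X -> \bar K) (A C : set X).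

Definition proper f : Prop := (forall x, f x != -oo%E) /\ exists x, (f x < +oo)%E.

(* Convexity is that of the epigraph, so that it makes sense for functions
   taking both infinite values. *)
Definition epigraph f : set (X * K^o) := [set p | (f p.1 <= p.2%:E)%E].

Definition econvex f : Prop := convex_set (epigraph f).

Definition Gamma0 : set (X -> \bar K) :=
  [set f | [/\ proper f, lower_semicontinuous f & econvex f]].

Definition edom f : set X := [set x | (f x < +oo)%E].

Definition indicator C : X -> \bar K :=
  fun x => if x \in C then 0%E else +oo%E.

Definition infconv f g : X -> \bar K :=
  fun x => ereal_inf [set (f y + g (x - y)%R)%E | y in [set: X]].

(* The pointwise supremum of the lower semicontinuous convex minorants of f is
   itself lower semicontinuous and convex, hence the largest of them. *)
Definition lsc_convex_hull f : X -> \bar K :=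
  fun x => ereal_sup [set h x | h in
    [set h | [/\ lower_semicontinuous h, econvex h & forall y, (h y <= f y)%E]]].

(* A real Hilbert space is a complete normed module X with a positive definite
   symmetric bilinear form inducing its norm; the last condition is not needed
   by the definitions and is left to the statements. *)
Context (dot : {dot X for idfun}).

Definition orthc A : set X := [set y | forall x, A x -> dot x y = 0].

Definition conjugate f : X -> \bar K :=
  fun u => ereal_sup [set ((dot x u)%:E - f x)%E | x in [set: X]].

(* This is the usual subdifferential for proper f. *)
Definition subdiff f (x : X) : set X :=
  [set u | forall y, (f x + (dot (y - x)%R u)%:E <= f y)%E].

(* (Id + subdiff f)^-1 x, as a set *)
Definition resolvent f (x : X) : set X :=
  [set p | exists2 u, subdiff f p u & x = p + u].

(* For f in Gamma0, resolvent f x is a singleton. *)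
Definition Prox f (x : X) : X := get (resolvent f x).

Section isometry.
Context (m : nat) (R : {linear X -> X}).

Definition FixR : set X := [set x | R x = x].

Definition spaceY : set X := orthc FixR.

Definition Smap (x : X) : X := R x - x.

Definition Qmap (x : X) : X :=
  m%:R^-1 *: \sum_(1 <= i < m) (i%:R : K) *: iter i R x.

Definition classical_cycles g : set X := [set z | z = Prox g (R z)].

Definition is_gap_pair g (p : X * X) : Prop :=
  let: (e, d) := p in
  [/\ spaceY e /\ spaceY d, d = Smap e, edom (conjugate g) d, e = Qmap d &
      forall y, spaceY y ->
        (conjugate g (Smap e) + (dot (y - Smap e)%R e)%:E - conjugate g y <= 0)%E].

(* is_gap_pair g has exactly one solution as soon as g is in Gamma0 and spaceY
   meets the domain of its conjugate. *)
Definition gap_pair g : X * X := get [set p | is_gap_pair g p].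

Definition pair_e g : X := (gap_pair g).1.

Definition pair_d g : X := (gap_pair g).2.

Definition phantom_fun f : X -> \bar K :=
  lsc_convex_hull (infconv f (indicator (orthc spaceY))).

Definition phantom_cycles f : set X := classical_cycles (phantom_fun f).

Definition phantom_gap f : X := pair_d (phantom_fun f).

End isometry.
End convex_analysis.

(* Main.v *)
Require Import Defs.
From mathcomp Require Import ring lra.

Set Implicit Arguments.
Unset Strict Implicit.
Unset Printing Implicit Defensive.

Import Order.TTheory GRing.Theory Num.Theory.

Local Open Scope classical_set_scope.
Local Open Scope ring_scope.

(** Write h for the conjugate of the phantom function g = cl (f [] iota_W), with
W the orthogonal of Y.  An affine minorant <., u> - c of g is the same thing as
a minorant of f [] iota_W, hence the same as a minorant of f whose slope u
is orthogonal to W; so h = f^* + iota_Y, since Y and Fix R are orthogonal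
complements of each other (conjugate_phantom_leP).  The conditions that define
a gap pair only involve the conjugate on Y, so f and g have the same gap pairs
(is_gap_pair_phantom), which is the second half of the theorem; moreover (e, Se)
is a gap pair of f exactly when e lies in Y and in the subdifferential of h at
Se (is_gap_pairP).

For the first half, z is a classical cycle of g iff Sz is a subgradient of g at
z, i.e. iff z is a subgradient of h at Sz.  As h is infinite off Y, only the
component e' of z along Y matters in this last condition, and Sz = Se'; so z is
a cycle iff (e', Se') is a gap pair, iff e' = e by uniqueness.

It remains to see that the gap pair exists and is unique.  On Y the operators S
and Q are inverse to each other, and the isometry gives
<Se, e> = - |Se|^2 / 2 (dot_Smap).  Hence - Q is strongly monotone on Y, while
subdifferentials are monotone: this is uniqueness.  Existence means solving
Q d in (subdiff h) d, a variational inequality for a Lipschitz strongly monotone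
operator, obtained by Banach's fixed point theorem applied to
d |-> prox (d + rho Q d) (strongly_monotone_inclusion).

Everything thus rests on the existence of proximal points (prox_exists), shown
with a minimizing sequence, Cauchy by the parallelogram law.  The inversion of
subdifferentials under conjugation is deduced from it as well
(subdiff_of_conjugate), which avoids separation theorems. *)

(** Conjugates are compared through their real upper bounds, because
those have a description by affine minorants (conjugate_leP). *)
Lemma ereal_eq_uboundP (K : realType) (a b : \bar K) :
  (forall c : K, (a <= c%:E)%E <-> (b <= c%:E)%E) -> a = b.
Proof.
move=> ab.
have le (x y : \bar K) :
    (forall c : K, (y <= c%:E)%E -> (x <= c%:E)%E) -> (x <= y)%E.
  case: y => [s||] xy; [by apply: xy | exact: leey |].
  case: x xy => [r||] xy //.
    have := xy (r - 1) (leNye _).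
    by rewrite lee_fin => ?; exfalso; lra.
  by have := xy 0 (leNye _); rewrite leye_eq.
by apply/eqP; rewrite eq_le; apply/andP; split; apply: le => c /ab.
Qed.

(** Only finite upper bounds of the values enter, so no arithmetic on infinite
values is needed. *)
Lemma econvexP (K : realType) (X : completeNormedModType K) (f : X -> \bar K) :
  econvex f <-> forall (x y : X) (r s t : K), 0 <= t -> t <= 1 ->
    (f x <= r%:E)%E -> (f y <= s%:E)%E ->
    (f (t *: x + (1 - t) *: y)%R <= (t * r + (1 - t) * s)%:E)%E.
Proof.
split => [cf x y r s t t0 t1 fx fy|cf [x r] [y s] l].
  have := cf (x, r : K^o) (y, s : K^o) (Itv01 t0 t1).
  rewrite !inE => /(_ fx fy); exact: id.
rewrite !inE /epigraph /= => fx fy.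
by apply: cf => //.
Qed.

(** * Real Hilbert spaces *)

Section inner_product.
Context {K : realType} {X : completeNormedModType K} (dot : {dot X for idfun}).
Hypothesis dot_norm : forall x : X, `|x| = Num.sqrt (dot x x).
Implicit Types x y z : X.

Lemma dotC x y : dot x y = dot y x.
Proof. by rewrite hermC expr0 mul1r. Qed.

Lemma dotZl (a : K) x y : dot (a *: x) y = a * dot x y.
Proof. exact: linearZl_LR. Qed.

Lemma dotZr (a : K) x y : dot x (a *: y) = a * dot x y.
Proof. by rewrite dotC dotZl dotC. Qed.

Lemma dotDl x y z : dot (x + y) z = dot x z + dot y z.
Proof. exact: linearDl. Qed.

Lemma dotDr x y z : dot z (x + y) = dot z x + dot z y.
Proof. exact: linearDr. Qed.

Lemma dotNl x y : dot (- x) y = - dot x y.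
Proof. exact: linearNl. Qed.

Lemma dotNr x y : dot y (- x) = - dot y x.
Proof. exact: linearNr. Qed.

Lemma dotBl x y z : dot (x - y) z = dot x z - dot y z.
Proof. exact: linearBl. Qed.

Lemma dotBr x y z : dot z (x - y) = dot z x - dot z y.
Proof. exact: linearBr. Qed.

Lemma dot0l x : dot 0 x = 0.
Proof. exact: linear0l. Qed.

Lemma dot0r x : dot x 0 = 0.
Proof. exact: linear0r. Qed.

Definition dotE := (dotDl, dotDr, dotBl, dotBr, dotNl, dotNr, dotZl, dotZr).

Lemma dotxx_ge0 x : 0 <= dot x x.
Proof.
have [->|x0] := eqVneq x 0; first by rewrite dot0l.
by apply: ltW; exact: neq0_dnorm_gt0.
Qed.

Lemma dotxx x : dot x x = `|x| ^+ 2.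
Proof. by rewrite dot_norm sqr_sqrtr ?dotxx_ge0. Qed.

Lemma dotxx_eq0 x : dot x x <= 0 -> x = 0.
Proof.
rewrite dotxx => x0; apply/eqP; rewrite -normr_eq0 -sqrf_eq0.
by rewrite eq_le x0 sqr_ge0.
Qed.

(** Cauchy-Schwarz: expand the square of |y| x - |x| y. *)
Lemma ler_dot_norm x y : dot x y <= `|x| * `|y|.
Proof.
have [->|x0] := eqVneq x 0; first by rewrite dot0l normr0 mul0r.
have [->|y0] := eqVneq y 0; first by rewrite dot0r normr0 mulr0.
have nx : 0 < `|x| by rewrite normr_gt0.
have ny : 0 < `|y| by rewrite normr_gt0.
have E : dot (`|y| *: x - `|x| *: y) (`|y| *: x - `|x| *: y) =
    (2 * (`|x| * `|y|)) * (`|x| * `|y| - dot x y).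
  by rewrite !dotE (dotC y x) (dotxx x) (dotxx y); ring.
have := dotxx_ge0 (`|y| *: x - `|x| *: y).
by rewrite E pmulr_rge0 ?subr_ge0// !mulr_gt0.
Qed.

Lemma dot_nbhs_gt x u (a : K) : a < dot x u ->
  exists2 V, nbhs u V & forall v, V v -> a < dot x v.
Proof.
move=> au; have x1 : 0 < `|x| + 1 by rewrite ltr_wpDl.
have d0 : 0 < (dot x u - a) / (`|x| + 1) by rewrite divr_gt0 ?subr_gt0.
exists (ball u ((dot x u - a) / (`|x| + 1))); first exact: nbhsx_ballx.
move=> v; rewrite -ball_normE /ball_/= ltr_pdivlMr// => uv.
have := ler_dot_norm x (u - v); rewrite dotBr.
have := normr_ge0 (u - v); nra.
Qed.

End inner_product.

(** * Conjugates and lower semicontinuous convex hulls *)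

Section conjugation.
Context {K : realType} {X : completeNormedModType K} (dot : {dot X for idfun}).
Hypothesis dot_norm : forall x : X, `|x| = Num.sqrt (dot x x).
Implicit Types (f g h k : X -> \bar K) (x y z u v : X) (A W : set X).

(** The epigraph of the conjugate parametrizes the affine minorants; this
holds for every f, with values -oo and +oo allowed. *)
Lemma conjugate_leP f u (c : K) :
  (conjugate dot f u <= c%:E)%E <-> forall x, ((dot x u - c)%:E <= f x)%E.
Proof.
have E x : ((dot x u)%:E - f x <= c%:E)%E = ((dot x u - c)%:E <= f x)%E.
  case: (f x) => [r||] /=; rewrite ?leey ?leNye//.
  by rewrite -EFinB !lee_fin lerBlDl -lerBlDr.
split => [fc x|fc].
  by rewrite -E; apply: le_trans fc; apply: ereal_sup_ubound; exists x.
by apply: ge_ereal_sup => _ [x _ <-]; rewrite E.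
Qed.

Lemma conjugate_ge f x u (r : K) :
  (f x <= r%:E)%E -> ((dot x u - r)%:E <= conjugate dot f u)%E.
Proof.
move=> fr.
have : ((dot x u)%:E - f x <= conjugate dot f u)%E.
  by apply: ereal_sup_ubound; exists x.
apply: le_trans; rewrite EFinB; exact: leeB.
Qed.

Lemma conjugate_lsc f : lower_semicontinuous (conjugate dot f).
Proof.
move=> u a /ereal_sup_gt[_ [x _ <-] ax].
have sup v : ((dot x v)%:E - f x <= conjugate dot f v)%E.
  by apply: ereal_sup_ubound; exists x.
case: (f x) ax sup => [r||] //= ax sup.
  have : a + r < dot x u by move: ax; rewrite -EFinB lte_fin; lra.
  move=> /(dot_nbhs_gt dot_norm)[V uV Va]; exists V => // v /Va av.
  by apply: lt_le_trans (sup v); rewrite -EFinB lte_fin; lra.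
by exists setT; [exact: filterT|move=> v _; apply: lt_le_trans (sup v)].
Qed.

Lemma affine_lsc u (c : K) :
  lower_semicontinuous (fun x : X => (dot x u - c)%:E).
Proof.
move=> x a; rewrite lte_fin ltrBrDr dotC => /(dot_nbhs_gt dot_norm)[V xV Va].
by exists V => // y /Va; rewrite lte_fin ltrBrDr dotC.
Qed.

Lemma conjugate_convex f : econvex (conjugate dot f).
Proof.
apply/econvexP => u v r s t t0 t1 /conjugate_leP fu /conjugate_leP fv.
apply/conjugate_leP => x; have := fu x; have := fv x.
case: (f x) => [q||]//=; rewrite ?leey//.
rewrite !lee_fin !dotE; nra.
Qed.

Lemma affine_convex u (c : K) : econvex (fun x : X => (dot x u - c)%:E).
Proof.
apply/econvexP => x y r s t t0 t1; rewrite !lee_fin !dotE; nra.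
Qed.

Lemma lsc_convex_hull_le f x : (lsc_convex_hull f x <= f x)%E.
Proof. by apply: ge_ereal_sup => _ [h [_ _ hf] <-]. Qed.

Lemma lsc_convex_hull_lsc f : lower_semicontinuous (lsc_convex_hull f).
Proof.
move=> x a /ereal_sup_gt[_ [h [lh ch hf] <-] /lh[V xV Va]].
exists V => // y /Va /lt_le_trans; apply.
by apply: ereal_sup_ubound; exists h.
Qed.

Lemma lsc_convex_hull_convex f : econvex (lsc_convex_hull f).
Proof.
apply/econvexP => x y r s t t0 t1 fx fy.
apply: ge_ereal_sup => _ [h [lh ch hf] <-].
move/econvexP : (ch); apply => //.
  by apply: le_trans fx; apply: ereal_sup_ubound; exists h.
by apply: le_trans fy; apply: ereal_sup_ubound; exists h.
Qed.

(** Affine functions are lower semicontinuous and convex, so f and its hull have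
the same affine minorants. *)
Lemma conjugate_lsc_convex_hull f :
  conjugate dot (lsc_convex_hull f) = conjugate dot f.
Proof.
apply/funext => u; apply: ereal_eq_uboundP => c.
split=> /conjugate_leP fc; apply/conjugate_leP => x.
  exact: le_trans (fc x) (lsc_convex_hull_le f x).
apply: ereal_sup_ubound; exists (fun x => (dot x u - c)%:E) => //.
by split => //; [exact: affine_lsc|exact: affine_convex].
Qed.

Lemma infconv_indicator_le f W x : W 0 ->
  (infconv f (indicator W) x <= f x)%E.
Proof.
move=> W0; apply: ereal_inf_lbound; exists x => //.
by rewrite subrr /indicator mem_set// adde0.
Qed.

(** The conjugate of an infimal convolution is the sum of the conjugates, and
the conjugate of the indicator of a subspace is the indicator of its orthogonal.
The equality is expressed on upper bounds to avoid adding infinite values. *)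
Lemma conjugate_infconv_indicator f A u (c : K) : proper f ->
  (conjugate dot (infconv f (indicator (orthc dot A))) u <= c%:E)%E <->
  orthc dot (orthc dot A) u /\ (conjugate dot f u <= c%:E)%E.
Proof.
move=> [fNy [x0 fx0]].
have W0 : orthc dot A 0 by move=> a _; rewrite dot0r.
split=> [/conjugate_leP fc|[Wu /conjugate_leP fc]].
  split; last first.
    apply/conjugate_leP => x; apply: le_trans (fc x) _.
    exact: infconv_indicator_le.
  move=> w Ww.
  have [r fr] : exists r : K, (f x0 <= r%:E)%E.
    by case: (f x0) fx0 => [r||]// _; [exists r|exists 0; rewrite leNye].
  (* Along the line x0 + t w the infimal convolution stays below f x0, while an
     affine minorant that is not constant on the line takes arbitrarily large
     values there. *)
  have bnd (t : K) : dot x0 u + t * dot w u - c <= r.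
    have := fc (x0 + t *: w); rewrite dotDl dotZl -lee_fin => /le_trans; apply.
    apply: le_trans fr; apply: ereal_inf_lbound; exists x0 => //.
    rewrite addrAC subrr add0r /indicator mem_set ?adde0//.
    by move=> a Aa; rewrite dotZr Ww ?mulr0.
  have [//|wu] := eqVneq (dot w u) 0.
  have := bnd ((r - dot x0 u + c + 1) / dot w u).
  by rewrite divfK//; lra.
apply/conjugate_leP => x; apply: le_ereal_inf_tmp => _ [y _ <-].
rewrite /indicator; case: ifPn => [/set_mem xy|_]; last first.
  by rewrite addey ?leey.
rewrite adde0; apply: le_trans (fc y).
by rewrite lee_fin -(subrK y x) dotDl Wu// add0r.
Qed.

Lemma conjugate_proper f : proper f -> edom (conjugate dot f) !=set0 ->
  proper (conjugate dot f).
Proof.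
move=> [fNy [x0 fx0]] [u fu]; split; last by exists u.
move=> v; rewrite gt_eqF//.
move: (fNy x0) fx0 (@conjugate_ge f x0 v).
case: (f x0) => [r||]// _ _ /(_ _ (lexx _)).
by apply: lt_le_trans; exact: ltNyr.
Qed.

Lemma conjugate_Gamma0 f : proper f -> edom (conjugate dot f) !=set0 ->
  Gamma0 (conjugate dot f).
Proof.
move=> pf df; split; [exact: conjugate_proper|exact: conjugate_lsc|].
exact: conjugate_convex.
Qed.

Lemma edom_conjugateP f u : edom (conjugate dot f) u <->
  exists c : K, (conjugate dot f u <= c%:E)%E.
Proof.
rewrite /edom /=; case: (conjugate dot f u) => [r||].
- by split => [_|_]; [exists r|exact: ltry].
- by split => [|[c]].
- by split => [_|_]; first by exists 0; rewrite leNye.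
Qed.

(** A proper f is finite somewhere, and each point where it is yields an affine
minorant of the conjugate. *)
Lemma edom_biconjugate f : proper f ->
  edom (conjugate dot (conjugate dot f)) !=set0.
Proof.
move=> [fNy [x0 fx0]]; exists x0; apply/edom_conjugateP.
have [r fr] : exists r : K, (f x0 <= r%:E)%E.
  by case: (f x0) fx0 => [r||]// _; [exists r|exists 0; rewrite leNye].
exists r; apply/conjugate_leP => u; rewrite dotC; exact: conjugate_ge.
Qed.

End conjugation.

(** * Existence of proximal points *)

(** First-order optimality along a segment: t (b + t c) is the variation of a
function with a minimum at t = 0. *)
Lemma ge0_first_order (K : realFieldType) (b c : K) :
  (forall t, 0 < t -> t < 1 -> 0 <= b + t * c) -> 0 <= b.
Proof.
move=> bc; rewrite leNgt; apply/negP => b0.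
have d0 : 0 < `|c| + 1 - b by have := normr_ge0 c; lra.
(* At this t the perturbation t * c is at most - b / 2. *)
pose t := - b / (2 * (`|c| + 1 - b)).
have tE : 2 * (`|c| + 1 - b) * t = - b.
  by rewrite /t; field; rewrite gt_eqF.
have t0 : 0 < t by rewrite divr_gt0 ?mulr_gt0 ?oppr_gt0.
have t1 : t < 1 by have := normr_ge0 c; nra.
have := bc t t0 t1; have := ler_norm c; nra.
Qed.

Section prox.
Context {K : realType} {X : completeNormedModType K} (dot : {dot X for idfun}).
Hypothesis dot_norm : forall x : X, `|x| = Num.sqrt (dot x x).
Implicit Types (f g h : X -> \bar K) (x y z u v : X).

Local Notation dotE := (dotE dot).
Local Notation dotxx := (dotxx dot_norm).
Local Notation dotxx_ge0 := (@dotxx_ge0 _ _ dot).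

Lemma lsc_seq_le h (y : nat -> X) (r : nat -> K) p (l : K) :
  lower_semicontinuous h -> (y n @[n --> \oo] --> p) ->
    (r n @[n --> \oo] --> l) ->
  (forall n, (h (y n) <= (r n)%:E)%E) -> (h p <= l%:E)%E.
Proof.
move=> lh yp rl hr; apply/lee_addgt0Pr => e e0; rewrite leNgt; apply/negP.
rewrite -EFinD => /lh[V pV hV].
have : \forall n \near \oo, (l + e < r n) by
  near=> n; rewrite -lte_fin; apply: lt_le_trans (hr n); apply: hV; near: n;
    exact: yp.
have : \forall n \near \oo, (r n < l + e).
  by apply: (cvgr_lt _ rl); rewrite ltrDl.
move=> A B; near \oo => n.
have : r n < l + e by near: n.
by rewrite ltNge => /negP; apply; apply: ltW; near: n.
Unshelve. all: by end_near. Qed.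

(** Parallelogram law, in the form that makes minimizing sequences Cauchy. *)
Lemma normsq_midpoint x y z :
  `|2^-1 *: y + (1 - 2^-1) *: z - x| ^+ 2 =
  2^-1 * `|y - x| ^+ 2 + 2^-1 * `|z - x| ^+ 2 - 4^-1 * `|y - z| ^+ 2.
Proof.
rewrite -!dotxx !dotE (dotC dot x y) (dotC dot x z) (dotC dot z y).
by field.
Qed.

Lemma normsq_segment x y p (t : K) :
  `|t *: y + (1 - t) *: p - x| ^+ 2 =
  `|p - x| ^+ 2 - 2 * t * dot (x - p) (y - p) + t ^+ 2 * `|y - p| ^+ 2.
Proof.
rewrite -!dotxx !dotE (dotC dot p x) (dotC dot y x) (dotC dot p y).
by ring.
Qed.

(** The proximal point of h at x with parameter 1 / lambda, characterized by its
optimality condition.  It minimizes q + h over X, with q the square of the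
distance to x times lambda / 2; finiteness of the conjugate of h somewhere
bounds this sum from below. *)
Lemma prox_exists h (lambda : K) x : 0 < lambda ->
  Gamma0 h -> edom (conjugate dot h) !=set0 ->
  exists p, subdiff dot h p (lambda *: (x - p)).
Proof.
move=> l0 [[hNy [x0 hx0]] lh /econvexP ch] [a /edom_conjugateP[c /conjugate_leP ac]].
pose q y : K := lambda / 2 * `|y - x| ^+ 2.
pose A : set K := [set s | exists y r, (h y <= r%:E)%E /\ s = r + q y].
have hA : has_inf A.
  split.
    have [r hr] : exists r : K, (h x0 <= r%:E)%E.
      by case: (h x0) hx0 => [r||]// _; [exists r|exists 0; rewrite leNye].
    by exists (r + q x0), x0, r.
  exists (dot x a - dot a a / (2 * lambda) - c) => _ [y [r [hr ->]]].
  have := le_trans (ac y) hr; rewrite lee_fin /q => ar.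
  (* Complete the square: the minimum of q + <., a> is at x - a / lambda. *)
  have : 0 <= q y + dot y a - dot x a + dot a a / (2 * lambda).
    have l2 : 0 < 2 / lambda by rewrite divr_gt0.
    rewrite -(pmulr_rge0 _ l2).
    have <- : dot (y - x + lambda^-1 *: a) (y - x + lambda^-1 *: a) =
        (2 / lambda) * (q y + dot y a - dot x a + dot a a / (2 * lambda)).
      rewrite /q -dotxx !dotE (dotC dot a y) (dotC dot a x) (dotC dot x y).
      by field; rewrite gt_eqF.
    exact: dotxx_ge0.
  by rewrite /q; lra.
(* mu is the infimum of h + q.  It is approached by points of the epigraph of h,
   which keeps the computation among real numbers. *)
pose mu := inf A.
have muP y r : (h y <= r%:E)%E -> mu <= r + q y.
  by move=> hr; apply: ge_inf; [exact: hA.2|exists y, r].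
have /choice[yr yrP] (n : nat) : exists yr : X * K,
    (h yr.1 <= yr.2%:E)%E /\ yr.2 + q yr.1 < mu + n.+1%:R^-1.
  have n0 : (0 : K) < n.+1%:R^-1 by rewrite invr_gt0.
  by have [_ [y [r [hr ->]]] lt] := inf_adherent n0 hA; exists (y, r).
pose y n := (yr n).1; pose r n := (yr n).2.
have hr n : (h (y n) <= (r n)%:E)%E := (yrP n).1.
have rq n : r n + q (y n) < mu + n.+1%:R^-1 := (yrP n).2.
have yC n k : `|y n - y k| ^+ 2 <= 4 / lambda * (n.+1%:R^-1 + k.+1%:R^-1).
  have half0 : (0 : K) <= 2^-1 by lra.
  have half1 : (2^-1 : K) <= 1 by lra.
  have := muP _ _ (ch _ _ _ _ 2^-1 half0 half1 (hr n) (hr k)).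
  rewrite /q normsq_midpoint => M.
  rewrite -(ler_pM2l (x := lambda / 4)); last by rewrite divr_gt0.
  have -> : lambda / 4 * (4 / lambda * (n.+1%:R^-1 + k.+1%:R^-1)) =
            n.+1%:R^-1 + k.+1%:R^-1 by field; rewrite !gt_eqF// ltr0n.
  have := rq n; have := rq k; rewrite /q.
  by move: (n.+1%:R^-1) (k.+1%:R^-1) => i j; lra.
have invn0 : (n.+1%:R^-1 : K) @[n --> \oo] --> (0 : K) by exact: cvg_harmonic.
have /cvg_ex[p yp] : cvgn y.
  apply/cauchy_cvgP; apply/cauchy_ballP => _/posnumP[e]; near_simpl.
  have d0 : 0 < e%:num ^+ 2 * lambda / 8
    by rewrite !(divr_gt0, mulr_gt0, exprn_gt0).
  have [N _ invN] := cvgr_lt _ invn0 _ d0.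
  exists ([set n | (N <= n)%N], [set n | (N <= n)%N]); first by split; exists N.
  move=> [n k] [/= Nn Nk]; rewrite -ball_normE /ball_/=.
  rewrite -(ltr_pXn2r (n := 2))// ?nnegrE ?normr_ge0 ?ltW//.
  apply: le_lt_trans (yC _ _) _.
  have n1 : n.+1%:R^-1 < e%:num ^+ 2 * lambda / 8 := invN n Nn.
  have n2 : k.+1%:R^-1 < e%:num ^+ 2 * lambda / 8 := invN k Nk.
  rewrite -(ltr_pM2l (x := lambda / 4)); last by rewrite divr_gt0.
  rewrite mulrA [_ * (4 / lambda)](_ : _ = 1); last by field; rewrite gt_eqF.
  by move: (n.+1%:R^-1) (k.+1%:R^-1) n1 n2 => i j; lra.
have hp : (h p <= (mu - q p)%:E)%E.
  apply: (lsc_seq_le lh yp (r := fun n => mu + n.+1%:R^-1 - q (y n))).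
    rewrite -[X in X - q p]addr0; apply: cvgB; first by apply: cvgD => //;
      exact: cvg_cst.
    apply: cvgM; first exact: cvg_cst.
    rewrite expr2; under eq_fun do rewrite expr2.
    by apply: cvgM; apply: cvg_norm; apply: cvgB => //; exact: cvg_cst.
  by move=> n; apply: le_trans (hr n) _; rewrite lee_fin lerBrDr ltW.
have hpE : h p = (mu - q p)%:E.
  apply/eqP; rewrite eq_le hp /=.
  case: (h p) (hNy p) (muP p) => [s _ /(_ _ (lexx _))|_ _|]//;
    last by rewrite leey.
  by rewrite lee_fin; lra.
exists p => z; rewrite hpE -EFinD.
case hz : (h z) (hNy z) => [s||]// _; last exact: leey.
rewrite lee_fin -subr_ge0.
apply: (@ge0_first_order _ _ (lambda / 2 * `|z - p| ^+ 2)) => t t0 t1.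
have := muP _ _ (ch z p s (mu - q p) t (ltW t0) (ltW t1) _ hp).
rewrite hz => /(_ (lexx _)); rewrite /q normsq_segment => M.
rewrite dotZr (dotC dot (z - p)) -(pmulr_rge0 _ t0).
have -> : t * (s - (mu - q p + lambda * dot (x - p) (z - p)) +
    t * (lambda / 2 * `|z - p| ^+ 2)) = 
   (t * s + (1 - t) * (mu - lambda / 2 * `|p - x| ^+ 2) +
    lambda / 2 * (`|p - x| ^+ 2 - 2 * t * dot (x - p) (z - p) +
    t ^+ 2 * `|z - p| ^+ 2)) - mu by rewrite /q; field.
by rewrite subr_ge0.
Unshelve. all: by end_near. Qed.

End prox.

(** * Subdifferentials and monotonicity *)

Section monotone.
Context {K : realType} {X : completeNormedModType K} (dot : {dot X for idfun}).
Hypothesis dot_norm : forall x : X, `|x| = Num.sqrt (dot x x).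
Implicit Types (f g h : X -> \bar K) (x y z u v : X).

Local Notation dotE := (dotE dot).
Local Notation dotxx := (dotxx dot_norm).

Lemma subdiff_fin h p u : proper h -> subdiff dot h p u ->
  exists r : K, h p = r%:E.
Proof.
move=> [hNy [x0 hx0]] /(_ x0) hu.
case: (h p) (hNy p) hu => [r||]// _; first by exists r.
by rewrite addye// leye_eq => /eqP hE; move: hx0; rewrite hE ltxx.
Qed.

Lemma subdiff_monotone h p q u v : proper h ->
  subdiff dot h p u -> subdiff dot h q v -> 0 <= dot (p - q) (u - v).
Proof.
move=> ph hu hv; have [r hr] := subdiff_fin ph hu;
  have [s hs] := subdiff_fin ph hv.
have := hu q; have := hv p; rewrite hr hs -!EFinD !lee_fin !dotE; lra.
Qed.

Lemma subdiff_conjugate g z u : proper g ->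
  subdiff dot g z u -> subdiff dot (conjugate dot g) u z.
Proof.
move=> pg gu v; have [r gr] := subdiff_fin pg gu.
have gu' : (conjugate dot g u <= (dot z u - r)%:E)%E.
  apply/conjugate_leP => y; apply: le_trans (gu y).
  by rewrite gr -EFinD lee_fin dotBl; lra.
apply: (@le_trans _ _ (dot z v - r)%:E); last by apply: conjugate_ge;
  rewrite gr.
apply: le_trans (leeD2r _ gu') _.
by rewrite -EFinD lee_fin dotBl (dotC dot u) (dotC dot v); lra.
Qed.

(** Take the proximal point p of g at z + u, and q = z + u - p, a subgradient of
g at p; then p is a subgradient of the conjugate at q.  Monotonicity of the
subdifferential of the conjugate gives 0 <= <u - q, z - p> = - |z - p|^2, so
that p = z and q = u. *)
Lemma subdiff_of_conjugate g z u : Gamma0 g -> edom (conjugate dot g) !=set0 ->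
  subdiff dot (conjugate dot g) u z -> subdiff dot g z u.
Proof.
move=> Gg dg gz; have pg : proper g by case: Gg.
have [p] := prox_exists dot_norm (z + u) ltr01 Gg dg.
rewrite scale1r; set q := z + u - p => gp.
have := subdiff_monotone (conjugate_proper pg dg) gz (subdiff_conjugate pg gp).
have -> : u - q = - (z - p) by rewrite /q addrAC opprD addrCA subrr addr0.
rewrite dotNl oppr_ge0 => /(dotxx_eq0 dot_norm)/eqP;
  rewrite subr_eq0 => /eqP zp.
by move: gp; rewrite /q -zp addrC addKr.
Qed.

Lemma resolvent_nonempty g x : Gamma0 g -> edom (conjugate dot g) !=set0 ->
  resolvent dot g x (Prox dot g x).
Proof.
move=> Gg dg; apply: getPex; have [p] := prox_exists dot_norm x ltr01 Gg dg.
by rewrite scale1r => gp; exists p, (x - p) => //; rewrite addrC subrK.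
Qed.

Lemma resolvent_unique g x p q : proper g ->
  resolvent dot g x p -> resolvent dot g x q -> p = q.
Proof.
move=> pg [u gu xu] [v gv xv].
have := subdiff_monotone pg gu gv.
have -> : u - v = - (p - q).
  have -> : u = x - p by rewrite xu addrC addKr.
  have -> : v = x - q by rewrite xv addrC addKr.
  by rewrite [- (x - q)]opprB addrC subrKA opprB.
by rewrite dotNr oppr_ge0 => /(dotxx_eq0 dot_norm)/eqP;
  rewrite subr_eq0 => /eqP.
Qed.

Lemma Prox_eqP g x p : Gamma0 g -> edom (conjugate dot g) !=set0 ->
  p = Prox dot g x <-> subdiff dot g p (x - p).
Proof.
move=> Gg dg; have pg : proper g by case: Gg.
have gP := resolvent_nonempty x Gg dg; split => [pE|gp].
  by have [u gu xu] := gP; rewrite pE {2}xu addrC addKr.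
apply: resolvent_unique pg _ gP.
by exists (x - p) => //; rewrite addrC subrK.
Qed.

(** The solutions of - M d in (subdiff h) d are the fixed points of
d |-> prox (d - M d / lambda), where prox has parameter 1 / lambda.  Proximal
maps are nonexpansive, and d |-> d - M d / lambda contracts as soon as
lambda > L^2 / (2 alpha). *)
Lemma strongly_monotone_inclusion h (M : X -> X) (alpha L : K) :
  0 < alpha -> 0 < L ->
  (forall x y, alpha * `|x - y| ^+ 2 <= dot (M x - M y) (x - y)) ->
  (forall x y, `|M x - M y| <= L * `|x - y|) ->
  Gamma0 h -> edom (conjugate dot h) !=set0 ->
  exists d, subdiff dot h d (- M d).
Proof.
move=> a0 L0 Ma ML Gh dh; have ph : proper h by case: Gh.
(* This value minimizes the Lipschitz bound
   1 - 2 alpha / lambda + L^2 / lambda^2 on the squares. *)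
pose lambda := L ^+ 2 / alpha.
have l0 : 0 < lambda by rewrite divr_gt0// exprn_gt0.
pose w x := x - lambda^-1 *: M x.
have /choice[T hT] x : exists p, subdiff dot h p (lambda *: (w x - p)).
  exact: prox_exists.
pose q : K := Num.sqrt (1 - alpha ^+ 2 / L ^+ 2).
have q1 : q < 1.
  rewrite -[ltRHS]sqrtr1 ltr_sqrt// ltrBlDr ltrDl.
  by rewrite divr_gt0// exprn_gt0.
have Tw x y : `|T x - T y| <= `|w x - w y|.
  have := subdiff_monotone ph (hT x) (hT y).
  rewrite -scalerBr dotZr pmulr_rge0//.
  have -> : w x - T x - (w y - T y) = (w x - w y) - (T x - T y).
    by rewrite opprD addrACA -opprD.
  rewrite dotBr dotxx subr_ge0 => le1.
  have := le_trans le1 (ler_dot_norm dot_norm _ _).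
  have := normr_ge0 (T x - T y); have := normr_ge0 (w x - w y).
  move: (`|T x - T y|) (`|w x - w y|) => a b; nra.
have wq x y : `|w x - w y| <= q * `|x - y|.
  rewrite -(ger0_norm (normr_ge0 (w x - w y))) -(ger0_norm (normr_ge0 (x - y))).
  rewrite -!sqrtr_sqr mulrC -sqrtrM ?sqr_ge0// ler_wsqrtr//.
  have -> : w x - w y = (x - y) - lambda^-1 *: (M x - M y).
    by rewrite /w scalerBr opprD addrACA -opprD.
  have := Ma x y; have := ML x y.
  move: (x - y) (M x - M y) => v z mv Dv.
  rewrite -[leLHS]dotxx dotBl !dotBr !dotZr !dotZl (dotC dot v) !dotxx.
  have := normr_ge0 z; move: mv Dv.
  move: (dot z v) (`|z|) (`|v|) => D m {}v mv Dv m0.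
  have m2 : m ^+ 2 <= L ^+ 2 * v ^+ 2.
    by rewrite -exprMn; apply: lerXn2r; rewrite ?nnegrE// (le_trans m0).
  have E1 : lambda^-1 = alpha / L ^+ 2 by rewrite /lambda invf_div.
  have i0 : 0 < lambda^-1 by rewrite invr_gt0.
  have E2 : lambda^-1 ^+ 2 * (L ^+ 2 * v ^+ 2) = alpha ^+ 2 / L ^+ 2 * v ^+ 2.
    by rewrite E1; field; rewrite gt_eqF.
  have E3 : lambda^-1 * (alpha * v ^+ 2) = alpha ^+ 2 / L ^+ 2 * v ^+ 2.
    by rewrite E1; field; rewrite gt_eqF.
  have i1 : lambda^-1 * (alpha * v ^+ 2) <= lambda^-1 * D by rewrite ler_pM2l.
  have i2 : lambda^-1 ^+ 2 * m ^+ 2 <= lambda^-1 ^+ 2 * (L ^+ 2 * v ^+ 2).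
    by rewrite ler_pM2l// exprn_gt0.
  rewrite E2 in i2; rewrite E3 in i1.
  by move: (lambda^-1) (alpha ^+ 2 / L ^+ 2) i1 i2 => i k; lra.
pose TF := mkfun_fun (fun x (_ : [set: X] x) => I : [set: X] (T x)).
have q0 : 0 <= q by exact: sqrtr_ge0.
have ctr : is_contraction TF.
  exists (NngNum q0); split => //= -[x y] _ /=.
  exact: le_trans (Tw x y) (wq x y).
have [d _ dE] := banach_fixed_point ctr closedT (ex_intro _ 0 I).
exists d; have := hT d.
have -> : T d = d by rewrite [RHS]dE.
by rewrite /w addrAC subrr add0r scalerN scalerA divff ?gt_eqF// scale1r.
Qed.

End monotone.

(** * Linear isometries of finite order *)

Section cyclic_isometry.
Context {K : realType} {X : completeNormedModType K} (dot : {dot X for idfun}).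
Hypothesis dot_norm : forall x : X, `|x| = Num.sqrt (dot x x).
Context (m : nat) (m_gt0 : (0 < m)%N) (R : {linear X -> X}).
Hypothesis R_isometry : forall x : X, `|R x| = `|x|.
Hypothesis R_order : forall x : X, iter m R x = x.
Implicit Types x y z u v w : X.

Local Notation dotE := (dotE dot).
Local Notation dotxx := (dotxx dot_norm).
Local Notation Y := (spaceY dot R).
Local Notation S := (Smap R).
Local Notation Q := (Qmap m R).

(** Polarization. *)
Lemma dot_isometry x y : dot (R x) (R y) = dot x y.
Proof.
have := dotxx (R (x + y)); rewrite R_isometry -dotxx linearD !dotE !dotxx.
rewrite !R_isometry (dotC dot y x) (dotC dot (R y)); lra.
Qed.

Lemma dot_iter_isometry i x y : dot (iter i R x) (iter i R y) = dot x y.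
Proof. by elim: i => //= i; rewrite dot_isometry. Qed.

Lemma normr_iter_isometry i x : `|iter i R x| = `|x|.
Proof. by elim: i => //= i; rewrite R_isometry. Qed.

Lemma iterB_linear i x y : iter i R (x - y) = iter i R x - iter i R y.
Proof. by elim: i => //= i ->; rewrite linearB. Qed.

(** Expand |Sx|^2 = |Rx|^2 - 2 <Rx, x> + |x|^2 with |Rx| = |x|.  This identity
is the only source of strong monotonicity in the whole argument. *)
Lemma dot_Smap x : dot (S x) x = - (`|S x| ^+ 2 / 2).
Proof.
rewrite -[`|_| ^+ 2]dotxx /Smap !dotE (dotC dot x (R x)) !dotxx R_isometry.
by field.
Qed.

(** This is the orthogonal projection onto the fixed points of R. *)
Definition cycle_mean x : X := m%:R^-1 *: \sum_(0 <= i < m) iter i R x.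

Local Notation P := cycle_mean.

Let m_neq0 : m%:R != 0 :> K.
Proof. by rewrite pnatr_eq0 -lt0n. Qed.

Lemma sum_shift_orbit x :
  \sum_(0 <= i < m) iter i.+1 R x = \sum_(0 <= i < m) iter i R x.
Proof.
apply/eqP; rewrite -subr_eq0 -sumrB.
by rewrite (telescope_sumr (fun i => iter i R x))// R_order subrr.
Qed.

Lemma fix_cycle_mean x : FixR R (P x).
Proof.
rewrite /FixR /= linearZ linear_sum /=; congr (_ *: _).
exact: sum_shift_orbit.
Qed.

Lemma iter_fix i w : FixR R w -> iter i R w = w.
Proof. by move=> Rw; elim: i => //= i ->. Qed.

Lemma cycle_mean_fix w : FixR R w -> P w = w.
Proof.
move=> Rw; rewrite /cycle_mean (eq_bigr (fun=> w)) => [|i _];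
  last exact: iter_fix.
by rewrite sumr_const_nat subn0 -[w *+ m]scaler_nat scalerA mulVf ?scale1r.
Qed.

Lemma dot_fix_cycle_mean w x : FixR R w -> dot w (P x) = dot w x.
Proof.
move=> Rw; rewrite dotZr linear_sumr/=.
rewrite (eq_bigr (fun=> dot w x)) => [|i _]; last first.
  by rewrite -{1}(iter_fix i Rw) dot_iter_isometry.
by rewrite sumr_const_nat subn0 -[dot w x *+ m]mulr_natl mulKf.
Qed.

Lemma sub_cycle_mean_spaceY x : Y (x - P x).
Proof. by move=> w Rw; rewrite dotBr dot_fix_cycle_mean// subrr. Qed.

Lemma cycle_mean_spaceY y : Y y -> P y = 0.
Proof.
move=> Yy; apply: (dotxx_eq0 dot_norm).
by rewrite dot_fix_cycle_mean ?Yy//; exact: fix_cycle_mean.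
Qed.

Lemma cycle_meanB x y : P (x - y) = P x - P y.
Proof.
rewrite /cycle_mean -scalerBr -sumrB; congr (_ *: _).
by apply: eq_bigr => i _; rewrite iterB_linear.
Qed.

Lemma orthc_spaceY : orthc dot Y = FixR R.
Proof.
apply/seteqP; split => w; last first.
  by move=> Rw y Yy; rewrite dotC Yy.
move=> Yw; suff -> : w = P w by exact: fix_cycle_mean.
apply/eqP; rewrite -subr_eq0; apply/eqP; apply: (dotxx_eq0 dot_norm).
rewrite dotBr Yw; last exact: sub_cycle_mean_spaceY.
by rewrite dotC sub_cycle_mean_spaceY ?subrr//; exact: fix_cycle_mean.
Qed.

Lemma Smap_spaceY x : Y (S x).
Proof. by move=> w Rw; rewrite dotBr -{1}Rw dot_isometry subrr. Qed.

Lemma SmapB x y : S (x - y) = S x - S y.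
Proof. by rewrite /Smap linearB opprD addrACA -opprD. Qed.

Lemma Smap_fix w : FixR R w -> S w = 0.
Proof. by rewrite /Smap => ->; rewrite subrr. Qed.

(** Including the vanishing index 0 lets the sum be compared with the one over a
full orbit. *)
Lemma QmapE x : Q x = m%:R^-1 *: \sum_(0 <= i < m) (i%:R : K) *: iter i R x.
Proof. by rewrite big_ltn// scale0r add0r. Qed.

Lemma QmapB x y : Q (x - y) = Q x - Q y.
Proof.
rewrite !QmapE -scalerBr -sumrB; congr (_ *: _).
by apply: eq_bigr => i _; rewrite iterB_linear scalerBr.
Qed.

Lemma Qmap_spaceY y : Y y -> Y (Q y).
Proof.
move=> Yy w Rw; rewrite QmapE dotZr linear_sumr/= big1 ?mulr0// => i _.
by rewrite dotZr -(iter_fix i Rw) dot_iter_isometry Yy// mulr0.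
Qed.

(** Summation by parts:
i (R^(i+1) x - R^i x) = ((i+1) R^(i+1) x - i R^i x) - R^(i+1) x, and the first
terms telescope to m x. *)
Lemma QmapS x : Q (S x) = x - P x.
Proof.
rewrite QmapE /cycle_mean.
rewrite (eq_bigr (fun i => (i.+1%:R *: iter i.+1 R x - i%:R *: iter i R x) -
    iter i.+1 R x)) => [|i _]; last first.
  rewrite /Smap iterB_linear -iterSr -addn1 natrD scalerDl scale1r scalerBr.
  by rewrite [RHS]addrAC addrK.
rewrite sumrB sum_shift_orbit (telescope_sumr (fun i => i%:R *: iter i R x))//.
by rewrite R_order scale0r subr0 scalerBr scalerA mulVf// scale1r.
Qed.

Lemma SmapQ x : S (Q x) = x - P x.
Proof.
rewrite -QmapS /Smap QmapB !QmapE linearZ linear_sum /=; congr (_ *: _ - _).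
by apply: eq_bigr => i _; rewrite linearZ /= -iterS iterSr.
Qed.

Lemma normr_cycle_mean x : `|P x| <= `|x|.
Proof.
rewrite normrZ ger0_norm ?invr_ge0// ler_pdivrMl ?ltr0n//.
apply: le_trans (ler_norm_sum _ _ _) _.
rewrite (eq_bigr (fun=> `|x|)) => [|i _]; last by rewrite normr_iter_isometry.
by rewrite sumr_const_nat subn0 mulr_natl.
Qed.

Lemma normr_Qmap x : `|Q x| <= m%:R * `|x|.
Proof.
rewrite QmapE normrZ ger0_norm ?invr_ge0// ler_pdivrMl ?ltr0n//.
apply: le_trans (ler_norm_sum _ _ _) _.
apply: (@le_trans _ _ (\sum_(0 <= i < m) m%:R * `|x|)); last first.
  by rewrite sumr_const_nat subn0 -[_ *+ m in leLHS]mulr_natl.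
apply: ler_sum_nat => i /andP[_ im].
rewrite normrZ normr_iter_isometry normr_nat ler_wpM2r// ler_nat.
exact: ltnW.
Qed.

(** The operator - Q is strongly monotone only on Y.  It is replaced by
M = P - Q (1 - P), which is strongly monotone on the whole space and agrees with
- Q on Y, where the solution lies since h is infinite elsewhere. *)
Lemma spaceY_inclusion h : Gamma0 h -> edom (conjugate dot h) !=set0 ->
  edom h `<=` Y -> exists d, Y d /\ subdiff dot h d (Q d).
Proof.
move=> Gh dh hY; have ph : proper h by case: Gh.
pose M x := P x - Q (x - P x).
have MB x y : M x - M y = M (x - y).
  rewrite /M cycle_meanB [RHS]addrC [LHS]addrC.
  have -> : x - y - (P x - P y) = (x - P x) - (y - P y).
    by rewrite opprD addrACA -opprD.
  by rewrite [in RHS]QmapB addrC opprD addrACA -opprD [RHS]addrC.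
have Mx x : 2^-1 * `|x| ^+ 2 <= dot (M x) x.
  have Yx := sub_cycle_mean_spaceY x; have Px := fix_cycle_mean x.
  have Q2 : dot (Q (x - P x)) (x - P x) = - (`|x - P x| ^+ 2 / 2).
    have := dot_Smap (Q (x - P x)).
    by rewrite SmapQ (cycle_mean_spaceY Yx) subr0 dotC.
  have xE : x = P x + (x - P x) by rewrite addrC subrK.
  rewrite /M.
  move: (P x) (x - P x) xE Yx Px Q2 => p v -> Yv Rp Q2.
  rewrite -!dotxx in Q2 *.
  rewrite dotBl !dotDr Q2 !dotDl (dotC dot v p) Yv//.
  rewrite (dotC dot (Q v) p) (Qmap_spaceY Yv Rp).
  have := dotxx_ge0 dot p; have := dotxx_ge0 dot v; lra.
have ML x : `|M x| <= (1 + 2 * m%:R) * `|x|.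
  rewrite /M; apply: le_trans (ler_normB _ _) _.
  have := normr_cycle_mean x; have := normr_Qmap (x - P x).
  have := ler_normB x (P x); have := normr_ge0 x.
  have : (0 : K) < m%:R by rewrite ltr0n.
  move: (m%:R : K) => k; nra.
have h0 : (0 : K) < 2^-1 by rewrite invr_gt0.
have L0 : (0 : K) < 1 + 2 * m%:R by rewrite ltr_pwDl// mulr_ge0.
have [x y|x y|d hd] := strongly_monotone_inclusion dot_norm h0 L0 (M := M) _ _ Gh dh.
- by rewrite MB; exact: Mx.
- by rewrite MB; exact: ML.
have Yd : Y d.
  by apply: hY; have [r hr] := subdiff_fin ph hd; rewrite /edom/= hr ltry.
exists d; split => //; move: hd.
by rewrite /M (cycle_mean_spaceY Yd) subr0 sub0r opprK.
Qed.

(** * Gap pairs and phantom cycles *)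

Section gap_pair.
Context (f : X -> \bar K).
Hypothesis f_Gamma0 : Gamma0 f.
Hypothesis f_dom : Y `&` edom (conjugate dot f) !=set0.

Local Notation g := (phantom_fun dot R f).
Local Notation h := (conjugate dot g).

Let pf : proper f. Proof. by case: f_Gamma0. Qed.

(** That is, the conjugate of g is f^* + iota_Y. *)
Lemma conjugate_phantom_leP u (c : K) :
  (h u <= c%:E)%E <-> Y u /\ (conjugate dot f u <= c%:E)%E.
Proof.
rewrite conjugate_lsc_convex_hull// conjugate_infconv_indicator//.
by rewrite orthc_spaceY.
Qed.

Lemma conjugate_phantom u : Y u -> h u = conjugate dot f u.
Proof.
move=> Yu; apply: ereal_eq_uboundP => c.
by rewrite conjugate_phantom_leP; split => [[]|].
Qed.

Lemma edom_conjugate_phantom : edom h = Y `&` edom (conjugate dot f).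
Proof.
apply/seteqP; split => u; rewrite /setI /= !edom_conjugateP.
  by move=> [c /conjugate_phantom_leP[Yu fc]]; split => //; exists c.
by move=> [Yu [c fc]]; exists c; apply/conjugate_phantom_leP.
Qed.

Lemma phantom_dom : edom h !=set0.
Proof. by rewrite edom_conjugate_phantom. Qed.

Lemma phantom_Gamma0 : Gamma0 g.
Proof.
split; [split|exact: lsc_convex_hull_lsc|exact: lsc_convex_hull_convex].
- move=> x; have [u /edom_conjugateP[c /conjugate_leP/(_ x) gx]] := phantom_dom.
  by rewrite gt_eqF//; apply: lt_le_trans gx; exact: ltNyr.
- have [_ [x fx]] := pf; exists x; apply: le_lt_trans fx.
  apply: le_trans (lsc_convex_hull_le _ _) _; apply: infconv_indicator_le.
  by move=> y _; rewrite dot0r.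
Qed.

Let pg : proper g. Proof. by case: phantom_Gamma0. Qed.
Let ph : proper h. Proof. exact: conjugate_proper pg phantom_dom. Qed.

(** Being a gap pair only depends on the restriction of the conjugate to Y. *)
Lemma is_gap_pair_phantom : is_gap_pair dot m R g = is_gap_pair dot m R f.
Proof.
apply/funext => -[e d]; apply/propext; rewrite /is_gap_pair.
split=> -[[Ye Yd] dE dd eE H]; split => //.
- by move: dd; rewrite edom_conjugate_phantom => -[].
- by move=> y Yy; have := H y Yy; rewrite -dE !conjugate_phantom.
- by rewrite edom_conjugate_phantom.
- by move=> y Yy; have := H y Yy; rewrite -dE !conjugate_phantom.
Qed.

Lemma is_gap_pairP e : is_gap_pair dot m R f (e, S e) <->
  Y e /\ subdiff dot h (S e) e.
Proof.
rewrite -is_gap_pair_phantom; split=> [[[Ye Yd] _ dd _ H]|[Ye he]].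
  split=> // y.
  have [Yy|nYy] := pselect (Y y); last first.
    suff -> : h y = +oo%E by rewrite leey.
    move: (ph.1 y) nYy; case hy : (h y) => [r||]// _ [].
    by have /conjugate_phantom_leP[] : (h y <= r%:E)%E by rewrite hy.
  move: (H y Yy) dd (ph.1 (S e)) (ph.1 y); rewrite /edom/=.
  case: (h (S e)) => [r||]//; case: (h y) => [s||]//= + _ _ _;
    last by rewrite leey.
  by rewrite -!EFinD -?EFinN !lee_fin; lra.
have [r hr] := subdiff_fin ph he.
split => //.
- by split => //; exact: Smap_spaceY.
- by rewrite /edom/= hr ltry.
- by rewrite QmapS (cycle_mean_spaceY Ye) subr0.
move=> y Yy; have := he y; rewrite hr -EFinD.
move: (ph.1 y); case: (h y) => [s||]// _.
  by rewrite -?EFinN -?EFinD !lee_fin; lra.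
by move=> _; rewrite leNye.
Qed.

(** Since S Q = 1 on Y, solving for e amounts to solving for d = Se in
Q d in (subdiff h) d. *)
Lemma gap_pair_exists : exists p, is_gap_pair dot m R f p.
Proof.
have hY : edom h `<=` Y by rewrite edom_conjugate_phantom => u [].
have [d [Yd hd]] := spaceY_inclusion
  (conjugate_Gamma0 dot_norm pg phantom_dom) (edom_biconjugate dot pg) hY.
exists (Q d, S (Q d)); apply/is_gap_pairP.
by rewrite SmapQ (cycle_mean_spaceY Yd) subr0; split => //; exact: Qmap_spaceY.
Qed.

Lemma gap_pair_spec : is_gap_pair dot m R f (pair_e dot m R f, pair_d dot m R f).
Proof.
have := getPex gap_pair_exists; rewrite -/(gap_pair dot m R f).
by rewrite /pair_e /pair_d; case: (gap_pair _ _ _ _).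
Qed.

(** Monotonicity gives 0 <= <Se - Se', e - e'>, while this number equals
- |S (e - e')|^2 / 2; and S is injective on Y. *)
Lemma gap_pair_unique e e' : is_gap_pair dot m R f (e, S e) ->
  is_gap_pair dot m R f (e', S e') -> e = e'.
Proof.
move=> /is_gap_pairP[Ye he] /is_gap_pairP[Ye' he'].
have := subdiff_monotone ph he he'.
have Yee : Y (e - e') by move=> w Rw; rewrite dotBr Ye// Ye'// subrr.
rewrite -SmapB dot_Smap oppr_ge0 -dotxx => le0.
have S0 : S (e - e') = 0 by apply: (dotxx_eq0 dot_norm); lra.
have := QmapS (e - e'); rewrite S0 (cycle_mean_spaceY Yee) subr0.
have -> : Q 0 = 0 by rewrite -[X in Qmap m R X](subrr e) QmapB subrr.
by move/esym/eqP; rewrite subr_eq0 => /eqP.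
Qed.

(** Subgradients of h at a point of Y are determined modulo Fix R only, because
h is infinite off Y. *)
Lemma subdiff_conjugate_phantom_fix u x y : Y u -> FixR R (x - y) ->
  subdiff dot h u x -> subdiff dot h u y.
Proof.
move=> Yu xy hx v.
have [|nYv] := pselect (edom h v); last first.
  suff -> : h v = +oo%E by rewrite leey.
  by apply/eqP; rewrite -leye_eq leNgt; apply/negP.
rewrite edom_conjugate_phantom => -[Yv _]; apply: le_trans (hx v).
have /eqP : dot (v - u) (x - y) = 0.
  by rewrite dotC dotBr Yv// Yu// subrr.
by rewrite dotBr subr_eq0 => /eqP ->.
Qed.

(** The resolvent condition z = Prox_g (R z) says that Rz - z = Sz is a
subgradient of g at z; conjugation turns it into a condition on the component
of z along Y. *)
Lemma phantom_cyclesP z :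
  phantom_cycles dot R f z <-> is_gap_pair dot m R f (z - P z, S z).
Proof.
have SE : S z = S (z - P z) by rewrite SmapB (Smap_fix (fix_cycle_mean z)) subr0.
rewrite [X in (_, X)]SE is_gap_pairP -SE.
have -> : phantom_cycles dot R f z <-> subdiff dot g z (S z).
  by apply: (Prox_eqP dot_norm); [exact: phantom_Gamma0|exact: phantom_dom].
have Pz := fix_cycle_mean z.
split => [gz|[_ hz]].
  split; first exact: sub_cycle_mean_spaceY.
  apply: (@subdiff_conjugate_phantom_fix (S z) z) (subdiff_conjugate pg gz).
    exact: Smap_spaceY.
  by rewrite subKr.
apply: (subdiff_of_conjugate dot_norm phantom_Gamma0 phantom_dom).
apply: subdiff_conjugate_phantom_fix hz; first exact: Smap_spaceY.
by rewrite addrAC subrr add0r /FixR/= linearN Pz.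
Qed.

Lemma phantom_cycles_fix z :
  phantom_cycles dot R f z <-> FixR R (z - pair_e dot m R f).
Proof.
have := gap_pair_spec; set e := pair_e _ _ _ _ => gp.
have [[Ye _] dE _ _ _] := gp; rewrite dE in gp.
have Fz := fix_cycle_mean z; rewrite phantom_cyclesP; split => [gz|Fze].
  have Sz : S z = S (z - P z) by rewrite SmapB (Smap_fix Fz) subr0.
  rewrite Sz in gz; rewrite (gap_pair_unique gp gz).
  by rewrite subKr.
have -> : P z = z - e.
  by rewrite -(cycle_mean_fix Fze) cycle_meanB (cycle_mean_spaceY Ye) subr0.
have -> : S z = S e by apply/eqP; rewrite -subr_eq0 -SmapB Smap_fix.
by rewrite subKr.
Qed.

End gap_pair.
End cyclic_isometry.

Theorem theorem5p1 (K : realType) (X : completeNormedModType K)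
    (dot : {dot X for idfun})
    (dot_norm : forall x : X, `|x| = Num.sqrt (dot x x))
    (m : nat) (m_gt0 : (0 < m)%N)
    (R : {linear X -> X})
    (R_isometry : forall x : X, `|R x| = `|x|)
    (R_order : forall x : X, iter m R x = x)
    (f : X -> \bar K) (f_Gamma0 : Gamma0 f)
    (f_dom : spaceY dot R `&` edom (conjugate dot f) !=set0) :
  let e := pair_e dot m R f in
  let d := pair_d dot m R f in
  let Z := phantom_cycles dot R f in
  [/\ Z !=set0,
      Z = [set e + w | w in orthc dot (spaceY dot R)],
      orthc dot (spaceY dot R) = FixR R &
      (FixR R <> [set 0] -> infinite_set Z)]
  /\
  [/\ phantom_gap dot m R f = d,
      spaceY dot R d,
      (forall z, Z z -> d = Smap R z) &
      pair_e dot m R (phantom_fun dot R f) = e].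
Proof.
move=> e d Z.
have perpY := orthc_spaceY dot_norm m_gt0 R_isometry R_order.
have ed := gap_pair_spec dot_norm m_gt0 R_isometry R_order f_Gamma0 f_dom.
rewrite -/e -/d in ed; have [[Ye Yd] dE _ _ _] := ed.
have ZP := phantom_cycles_fix dot_norm m_gt0 R_isometry R_order f_Gamma0 f_dom.
have ZE : Z = [set e + w | w in orthc dot (spaceY dot R)].
  rewrite perpY; apply/seteqP; split => z.
    by move=> /ZP Fz; exists (z - e) => //; rewrite addrC subrK.
  by move=> [w Fw <-]; apply/ZP; rewrite addrC addKr.
have F0 : FixR R 0 by exact: linear0.
split; split => //.
- by rewrite ZE perpY; exists (e + 0), 0.
- move=> RN; have [w [Fw w0]] : exists w, FixR R w /\ w != 0.
    apply: contrapT => N; apply: RN; apply/seteqP; split => w /=;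
      last by move=> ->.
    move=> Fw; apply/eqP; apply: contrapT => /negP w0; apply: N.
    by exists w.
  pose u (n : nat) := e + n%:R *: w.
  have uZ : u @^-1` Z = setT.
    apply/seteqP; split => // n _; apply/ZP.
    by rewrite /u addrC addKr /FixR/= linearZ/= Fw.
  have uI : injective u.
    move=> i j /addrI/eqP; rewrite -subr_eq0 -scalerBl scaler_eq0 (negPf w0) orbF.
    by rewrite subr_eq0 eqr_nat => /eqP.
  move=> finZ; apply: infinite_nat; rewrite -uZ.
  by apply: finite_preimage finZ; exact: in2W.
- by rewrite /phantom_gap /pair_d /gap_pair is_gap_pair_phantom.
- move=> z /ZP Fz; rewrite dE; apply/esym/eqP; rewrite -subr_eq0 -SmapB.
  by rewrite Smap_fix.
- by rewrite /e /pair_e /gap_pair is_gap_pair_phantom.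
Qed.
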